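(* Let $q\ge1$ be an integer and let $G_*$ be a central filtration on a group $G$. Then $\mathcal A_j(G_* )\subseteq\mathcal A_j(G_*^{(q)})$ for all $j\ge0$.
   Context: A filtration $G_*$ on a group $G$ is a sequence of subgroups $G=G_1\supseteq G_2\supseteq\cdots$; it is central if $[G,G_i]\subseteq G_{i+1}$ for all $i\ge1$. A central filtration is of $q$-torsion if $g^q\in G_{i+1}$ for all $i\ge1$ and $g\in G_i$. For a central filtration $G_*$, $G_*^{(q)}$ is the smallest $q$-torsion central filtration on $G$ containing $G_*$ termwise (it exists). For a filtration $G_*$ by normal subgroups, $\mathcal A_0(G_* )$ is the group of automorphisms $\varphi$ of $G$ such that $\varphi(G_i)\subseteq G_i$ and $\varphi^{-1}(G_i)\subseteq G_i$ for all $i$; for $j\ge1$, $\mathcal A_j(G_* )$ is the subgroup of those $\varphi\in\mathcal A_0(G_* )$ such that $\varphi(g)g^{-1}\in G_{i+j}$ for all $i\ge1$ and $g\in G_i$. *)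

(* Defs.v *)
From mathcomp Require Import all_boot.
From mathcomp Require Import boolp classical_sets.

Set Implicit Arguments.
Unset Strict Implicit.
Unset Printing Implicit Defensive.

Local Open Scope classical_set_scope.
Local Open Scope group_scope.

Section Filtrations.
Variable G : groupType.
Implicit Types (A B H : set G) (F E : nat -> set G) (q i j : nat).

Definition subgroup H : Prop := group_closed [in H].

Definition generated A : set G := smallest subgroup A.

Definition commutator A B : set G :=
  generated [set [~ a, b] | a in A & b in B].

(* A sequence G_1, G_2, ... is a function on nat whose value at 0 is junk:
   every condition below only concerns positive indices. *)
Definition filtration F : Prop :=
  [/\ F 1%N = [set: G],
      forall i, (0 < i)%N -> subgroup (F i) &
      forall i, (0 < i)%N -> F i.+1 `<=` F i].

Definition central_filtration F : Prop :=
  filtration F /\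
  forall i, (0 < i)%N -> commutator [set: G] (F i) `<=` F i.+1.

Definition torsion_filtration q F : Prop :=
  forall i, (0 < i)%N -> forall g, F i g -> F i.+1 (g ^+ q).

Definition subfiltration F E : Prop := forall i, (0 < i)%N -> F i `<=` E i.

(* The termwise intersection of all q-torsion central filtrations containing F;
   torsion_closureP shows that it is the smallest of them. *)
Definition torsion_closure q F : nat -> set G := fun i =>
  \bigcap_(E in [set E | [/\ central_filtration E, torsion_filtration q E
                           & subfiltration F E]]) E i.

(* phi @^-1` F i is also the image of F i under the inverse of phi. *)
Definition filtered_aut0 F : set {multiplicative G -> G} :=
  [set phi : {multiplicative G -> G} | bijective phi /\
    forall i, (0 < i)%N -> phi @` F i `<=` F i /\ phi @^-1` F i `<=` F i].

Definition filtered_aut j F : set {multiplicative G -> G} :=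
  if j is 0 then filtered_aut0 F else
  [set phi : {multiplicative G -> G} | filtered_aut0 F phi /\
    forall i, (0 < i)%N -> forall g, F i g -> F (i + j)%N (phi g / g)].

Lemma subgroupP H :
  subgroup H <-> H 1 /\ forall x y, H x -> H y -> H (x / y).
Proof.
split=> [[/set_mem H1 HB]|[H1 HB]].
  by split=> // x y Hx Hy; apply/set_mem/HB; apply: mem_set.
split; first exact: mem_set.
by move=> x y /set_mem Hx /set_mem Hy; apply/mem_set/HB.
Qed.

Lemma commutator_sub A B H : subgroup H ->
  commutator A B `<=` H <-> forall a b, A a -> B b -> H [~ a, b].
Proof.
move=> sH; split=> [ABH a b Aa Bb|ABH].
  by apply: ABH => K [_ sK]; apply: sK; exists a => //; exists b.
by apply: smallest_sub => // _ [a Aa [b Bb <-]]; apply: ABH.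
Qed.

Lemma torsion_closureP q F :
  let Fq := torsion_closure q F in
  [/\ central_filtration Fq, torsion_filtration q Fq, subfiltration F Fq &
      forall E, central_filtration E -> torsion_filtration q E ->
        subfiltration F E -> subfiltration Fq E].
Proof.
have sFq i : (0 < i)%N -> subgroup (torsion_closure q F i).
  move=> i0; apply/subgroupP; split=> [E|x y Fx Fy E /[dup] EP] [[[_ sE _] _] _ _].
    by have /subgroupP[] := sE i i0.
  by have /subgroupP[_] := sE i i0; apply; [apply: Fx | apply: Fy].
split.
- split; [split=> // |].
  + by rewrite -subTset => x _ E [[[-> _ _] _] _ _].
  + move=> i i0 x Fx E /[dup] EP [[[_ _ dE] _] _ _].
    by apply: dE => //; apply: Fx.
  + move=> i i0; apply/commutator_sub; first exact: sFq.
    move=> a b _ Fb E /[dup] EP [[[_ sE _] cE] _ _].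
    have /commutator_sub := cE i i0; apply => //; [exact: sE | exact: Fb].
- move=> i i0 g Fg E /[dup] EP [_ tE _]; apply: tE => //; exact: Fg.
- by move=> i i0 x Fx E [_ _ FE]; apply: FE.
- by move=> E cE tE FE i i0 x; apply.
Qed.

End Filtrations.

(* Main.v *)
Require Import Defs.
From mathcomp Require Import all_boot.
From mathcomp Require Import boolp classical_sets.

Local Open Scope classical_set_scope.

(** Let [F] be a central filtration and write [F^q] for its [q]-torsion closure.
    An automorphism [phi] moves a power by
    [phi (y ^+ q) / y ^+ q = (a * y) ^+ q / y ^+ q] with [a := phi y / y], and
    this is [a ^+ q] up to terms one step deeper, as [a] is central modulo the
    next step.  So taking [q]-th powers is harmless; what is delicate is
    closure under commutators, since [F] is only assumed to satisfy
    [[G, F i] <= F (i + 1)], and not [[F i, F j] <= F (i + j)]: for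
    [phi g / g \in F^q (1 + j)] and [h \in F^q i], centrality alone does not
    place [[phi g / g, h]] as deep as [F^q (i + 1 + j)].

    The remedy is a construction of [F^q] in which commutators need not be
    adjoined.  The single step
      [torsion_step D k := < D (k + 1), y ^+ q for y in D k >]
    turns a descending central chain into a descending central chain
    ([torsion_step_chain]), and [l] steps applied to [F] give subgroups
    [F_(k, l)] whose first ones are the closure: [F^q (l + 1) = F_(1, l)], and
    [F_(k, l) <= F^q (k + l)] in general.  Keeping both indices is the point:
    it records [[G, F_(k, l)] <= F_(k + 1, l)], that is, commutators move [k]
    and leave the number of powers alone.

    If [phi] displaces [D k] into [D (k + j)] for all [k], it does the same for
    [torsion_step D], by the computation above ([torsion_step_shifts]).
    Centrality of [torsion_step D] is itself the instance of this where [phi] is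
    a conjugation and [j = 1], and invariance of the [F^q i] under an
    automorphism is the instance [j = 0]; thus one induction gives all cases. *)

(** * Chains of subgroups and the maps that shift them *)

Section Chains.
Local Open Scope group_scope.
Context {G : groupType}.
Implicit Types (phi : G -> G) (H : set G) (D F : nat -> set G)
  (q k j n l : nat).

Definition shifts phi j D : Prop :=
  forall k, (0 < k)%N -> forall x, D k x -> D (k + j)%N (phi x / x).

(** Unlike a central filtration, such a chain need not start at the whole group;
    centrality, [[G, D k] <= D (k + 1)], is put in the form in which it is
    a property of the same kind as the one under study. *)
Definition central_chain D : Prop :=
  [/\ forall k, (0 < k)%N -> subgroup (D k),
      forall k, (0 < k)%N -> D k.+1 `<=` D k &
      forall g, shifts (conjg^~ g) 1 D].

Lemma subgroup1 H : subgroup H -> H 1.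
Proof. by case/subgroupP. Qed.

Lemma subgroup_div H x y : subgroup H -> H x -> H y -> H (x / y).
Proof. by case/subgroupP=> _; apply. Qed.

Lemma subgroupV H x : subgroup H -> H x -> H x^-1.
Proof.
by move=> sH Hx; rewrite -div1g; apply: subgroup_div => //; apply: subgroup1.
Qed.

Lemma subgroupM H x y : subgroup H -> H x -> H y -> H (x * y).
Proof.
by move=> sH Hx Hy; rewrite -(invgK y); apply: subgroup_div => //;
  apply: subgroupV.
Qed.

Lemma subgroupX H x n : subgroup H -> H x -> H (x ^+ n).
Proof.
move=> sH Hx; elim: n => [|n IHn]; first exact: subgroup1.
by rewrite expgS; apply: subgroupM.
Qed.

Lemma subgroup_generated H : subgroup (generated H).
Proof.
apply/subgroupP; split=> [K [sK _]|x y Hx Hy K KH]; first exact: subgroup1.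
by apply: subgroup_div; [case: KH | apply: Hx | apply: Hy].
Qed.

Lemma morph_div phi : {morph phi : x y / x * y} -> {morph phi : x y / x / y}.
Proof.
by move=> phiM x y; rewrite -[in RHS](mulgVK y x) (phiM (x / y)) mulgK. Qed.

Lemma morph_one phi : {morph phi : x y / x * y} -> phi 1 = 1.
Proof. by move=> phiM; rewrite -(mulgV 1) morph_div // !mulgV. Qed.

Lemma morph_expg phi n : {morph phi : x y / x * y} -> {morph phi : x / x ^+ n}.
Proof.
move=> phiM x; elim: n => [|n IHn]; first exact: morph_one.
by rewrite !expgS phiM IHn.
Qed.

(** Pointwise, [phi (x / y) / (x / y)] is [phi x / x] times a conjugate of the
    inverse of [phi y / y]. *)
Lemma subgroup_displacement phi H : {morph phi : x y / x * y} ->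
    subgroup H -> (forall x g, H x -> H (x ^ g)) ->
  subgroup [set x | H (phi x / x)].
Proof.
move=> phiM sH nH.
apply/subgroupP; split=> [|x y Hx Hy] /=.
  by rewrite morph_one // mulgV; apply: subgroup1.
have -> : phi (x / y) / (x / y) = (phi x / x) * ((phi y / y)^-1 ^ (y * x^-1)).
  by rewrite morph_div // conjgE !invgM !invgK !mulgA !mulgVK.
by apply: subgroupM => //; apply: nH; apply: subgroupV.
Qed.

Lemma central_chain_conjg D k x g : central_chain D -> (0 < k)%N ->
  D k x -> D k (x ^ g).
Proof.
case=> sD dD cD k0 Dx; rewrite -(mulgVK x (x ^ g)).
apply: subgroupM => //; first exact: sD.
by apply: dD => //; rewrite -addn1; apply: cD.
Qed.

(** Modulo [D k.+1] the element [a] is central, so powers distribute. *)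
Lemma central_chain_expgMn D k a y n : central_chain D -> (0 < k)%N ->
  D k a -> exists2 z, D k.+1 z & (a * y) ^+ n = z * a ^+ n * y ^+ n.
Proof.
move=> cD k0 Da; have [sD dD zD] := cD.
elim: n => [|n [z Dz IHn]].
  by exists 1; [apply: subgroup1; apply: sD | rewrite !mulg1].
(* Moving the last [a] to the left of [y ^+ n] costs [w], and moving [w] to the
   left of [a ^+ n] costs a conjugation. *)
pose w := a ^ (y ^- n) / a.
have Dw : D k.+1 w by rewrite -addn1; apply: zD.
exists (z * w ^ (a ^- n)).
  by apply: subgroupM => //; [apply: sD | apply: central_chain_conjg].
rewrite !expgSr IHn /w !conjgE !invgK !mulgA.
by rewrite !mulgVK.
Qed.

(** * One step towards the torsion closure *)

Definition torsion_step q D : nat -> set G := fun k =>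
  generated (D k.+1 `|` [set y ^+ q | y in D k]).

Lemma torsion_step_sub q D H k : subgroup H -> D k.+1 `<=` H ->
  (forall y, D k y -> H (y ^+ q)) -> torsion_step q D k `<=` H.
Proof.
by move=> sH DH qH; apply: smallest_sub => // x [/DH //|[y Dy <-]]; apply: qH.
Qed.

Lemma sub_torsion_step q D k : D k.+1 `<=` torsion_step q D k.
Proof. by move=> x Dx; apply: sub_gen_smallest; left. Qed.

Lemma torsion_step_expg q D k y : D k y -> torsion_step q D k (y ^+ q).
Proof. by move=> Dy; apply: sub_gen_smallest; right; exists y. Qed.

Lemma torsion_step_conjg q D k x g : central_chain D -> (0 < k)%N ->
  torsion_step q D k x -> torsion_step q D k (x ^ g).
Proof.
move=> cD k0.
have sT : subgroup (torsion_step q D k) by apply: subgroup_generated.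
move: x.
suff: torsion_step q D k `<=` [set x | torsion_step q D k (x ^ g)] by [].
apply: torsion_step_sub.
- apply/subgroupP; split=> [|x y Tx Ty] /=.
    by rewrite conj1g; apply: (subgroup1 _ sT).
  by rewrite conjMg conjVg; apply: (subgroup_div _ _ _ sT).
- by move=> x Dx; apply: sub_torsion_step; apply: central_chain_conjg.
- move=> y Dy /=; rewrite conjXg; apply: torsion_step_expg.
  exact: central_chain_conjg.
Qed.

(** On a generator [y ^+ q] the displacement is [(phi y / y) ^+ q] up to an
    element of [D (k + j).+1], and both factors lie in the step. *)
Lemma torsion_step_shifts q D phi j : {morph phi : x y / x * y} ->
  central_chain D -> shifts phi j D -> shifts phi j (torsion_step q D).
Proof.
move=> phiM cD phiD k k0; have kj0 : (0 < k + j)%N by rewrite addn_gt0 k0.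
have sT : subgroup (torsion_step q D (k + j)%N)
  by apply: subgroup_generated.
suff: torsion_step q D k `<=`
  [set x | torsion_step q D (k + j)%N (phi x / x)] by apply.
apply: torsion_step_sub.
- by apply: subgroup_displacement => // x g; apply: torsion_step_conjg.
- by move=> x Dx; apply: sub_torsion_step; rewrite -addSn; apply: phiD.
- move=> y Dy /=.
  have Da : D (k + j)%N (phi y / y) by apply: phiD.
  have -> : phi (y ^+ q) = (phi y / y * y) ^+ q.
    by rewrite mulgVK morph_expg.
  have [z Dz ->] := central_chain_expgMn _ _ _ y q cD kj0 Da.
  rewrite mulgK; apply: (subgroupM _ _ _ sT); first exact: sub_torsion_step.
  exact: torsion_step_expg.
Qed.

Lemma torsion_step_chain q D : central_chain D ->
  central_chain (torsion_step q D).
Proof.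
move=> cD; have [sD dD zD] := cD; split=> [k _|k k0|g].
- exact: subgroup_generated.
- apply: torsion_step_sub; first exact: subgroup_generated.
    by move=> x Dx; apply: sub_torsion_step; apply: dD.
  by move=> y Dy; apply: torsion_step_expg; apply: dD.
- by apply: torsion_step_shifts => // x y; apply: conjMg.
Qed.

(** * The torsion closure by iterated steps *)

Lemma iter_torsion_step_chain q D l : central_chain D ->
  central_chain (iter l (torsion_step q) D).
Proof. by move=> cD; elim: l => //= l; apply: torsion_step_chain. Qed.

Lemma iter_torsion_step_shifts q D phi j l : {morph phi : x y / x * y} ->
  central_chain D -> shifts phi j D ->
  shifts phi j (iter l (torsion_step q) D).
Proof.
move=> phiM cD phiD; elim: l => //= l IHl; apply: torsion_step_shifts => //.
exact: iter_torsion_step_chain.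
Qed.

Lemma sub_iter_torsion_step q D k l :
  D (k + l)%N `<=` iter l (torsion_step q) D k.
Proof.
elim: l k => [|l IHl] k; first by rewrite addn0.
by rewrite addnS -addSn => x Dx; apply: sub_torsion_step; apply: IHl.
Qed.

Lemma central_filtration_chain F : central_filtration F -> central_chain F.
Proof.
case=> [[_ sF dF] cF]; split=> // g k k0 x Fx.
have -> : x ^ g / x = [~ g, x^-1] by rewrite commgEl !conjgE invgK !mulgA.
rewrite addn1; have /commutator_sub := cF k k0; apply=> //.
  exact: sF.
by apply: subgroupV => //; apply: sF.
Qed.

Lemma torsion_closure_sub_iter q F l : central_filtration F ->
  torsion_closure q F l.+1 `<=` iter l (torsion_step q) F 1%N.
Proof.
move=> cF.
have cD := iter_torsion_step_chain q _ _ (central_filtration_chain _ cF).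
pose E i := iter i.-1 (torsion_step q) F 1%N.
have [_ _ _ minFq] := torsion_closureP q F.
apply: (minFq E) => //.
- split; [split=> [|i _|[//|i] _] | case=> [//|i] _].
  + by case: cF => [[]].
  + by have [sD _ _] := cD i.-1; apply: sD.
  + have [sD dD _] := cD i; apply: torsion_step_sub; first exact: sD.
      exact: dD.
    by move=> y Dy; apply: subgroupX => //; apply: sD.
  + apply/commutator_sub; first exact: subgroup_generated.
    move=> g x _ Dx; apply: sub_torsion_step.
    have [sD _ zD] := cD i.
    have -> : [~ g, x] = x^-1 ^ g / x^-1
      by rewrite commgEl !conjgE invgK !mulgA.
    by rewrite -(addn1 1); apply: zD => //; apply: subgroupV => //; apply: sD.
- by case=> [//|i] _ g Dg; apply: torsion_step_expg.
- case=> [//|i] _; exact: (@sub_iter_torsion_step q F 1 i).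
Qed.

Lemma iter_sub_torsion_closure q F k l : central_filtration F -> (0 < k)%N ->
  iter l (torsion_step q) F k `<=` torsion_closure q F (k + l)%N.
Proof.
move=> cF; have [[[_ sFq _] _] tFq FFq _] := torsion_closureP q F.
elim: l k => [|l IHl] k k0; first by rewrite addn0; apply: FFq.
rewrite addnS; apply: torsion_step_sub; first exact: sFq.
  by rewrite -addSn; apply: IHl.
by move=> y Dy; apply: tFq; [rewrite addn_gt0 k0 | apply: IHl].
Qed.

Lemma torsion_closure_shifts q F phi j : {morph phi : x y / x * y} ->
  central_filtration F -> shifts phi j F ->
  shifts phi j (torsion_closure q F).
Proof.
move=> phiM cF phiF [//|l] _ x /(torsion_closure_sub_iter _ _ _ cF) Dx.
have -> : (l.+1 + j = (1 + j) + l)%N by rewrite addnAC.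
apply: iter_sub_torsion_closure => //.
by apply: iter_torsion_step_shifts => //; apply: central_filtration_chain.
Qed.

(** This makes [j = 0] an instance of the general case: [D k] being a subgroup,
    [phi x / x] lies in it together with [phi x]. *)
Lemma shifts0P phi D : (forall k, (0 < k)%N -> subgroup (D k)) ->
  shifts phi 0 D <-> forall k, (0 < k)%N -> forall x, D k x -> D k (phi x).
Proof.
move=> sD; split=> phiD k k0 x Dx.
  rewrite -(mulgVK x (phi x)); apply: subgroupM => //; first exact: sD.
  by rewrite -{1}(addn0 k); apply: phiD.
by rewrite addn0; apply: subgroup_div; [apply: sD | apply: phiD |].
Qed.

Lemma torsion_closure_stable q F phi : {morph phi : x y / x * y} ->
    central_filtration F ->
    (forall k, (0 < k)%N -> forall x, F k x -> F k (phi x)) ->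
  forall k, (0 < k)%N -> forall x,
    torsion_closure q F k x -> torsion_closure q F k (phi x).
Proof.
move=> phiM cF phiF; have [[[_ sFq _] _] _ _ _] := torsion_closureP q F.
apply/shifts0P => //; apply: torsion_closure_shifts => //.
by apply/shifts0P => //; case: cF => [[]].
Qed.

Lemma filtered_aut0_torsion_closure q F : central_filtration F ->
  filtered_aut0 F `<=` filtered_aut0 (torsion_closure q F).
Proof.
move=> cF phi [[psi phiK psiK] phiF]; split; first by exists psi.
move=> i i0; split=> [_ [x Fx <-]|x Fx].
  apply: torsion_closure_stable => //; first exact: gmulfM.
  by move=> k k0 y Fy; apply: (phiF k k0).1; exists y.
rewrite -(phiK x); apply: torsion_closure_stable => //.
  exact: can2_gmulfM.
by move=> k k0 y Fy; apply: (phiF k k0).2; rewrite /= psiK.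
Qed.

End Chains.

Theorem proposition5p2 (q : nat) (q_ge1 : (1 <= q)%N) (G : groupType)
    (F : nat -> set G) (F_central : central_filtration F) (j : nat) :
  filtered_aut j F `<=` filtered_aut j (torsion_closure q F).
Proof.
case: j => [|j]; first exact: filtered_aut0_torsion_closure.
move=> phi [phi0 phiF]; split; first exact: filtered_aut0_torsion_closure.
by apply: torsion_closure_shifts => //; apply: gmulfM.
Qed.
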